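(* Let $p,q>0$ be real numbers. The function $\phi:\mathbb{R}^2\to\mathbb{R}$ defined by $\phi(s,t)=ps^2-pqst+qt^2$ if $s<0$ and $t>0$, and $\phi(s,t)=ps^2+pqst+qt^2$ otherwise, is a conserved quantity for the dynamical system generated by $\mathfrak{m}$; that is, $\phi\circ\mathfrak{m}=\phi$ on $\mathbb{R}^2$.
   Context: Write $[x]_+=\max(x,0)$. For positive reals $p,q$, the maps $\mathfrak{m}_1,\mathfrak{m}_2:\mathbb{R}^2\to\mathbb{R}^2$ are $\mathfrak{m}_1(s,t)=(-s,\ t+p[s]_+)$ and $\mathfrak{m}_2(s,t)=(s+q[t]_+,\ -t)$, and the tropical map is $\mathfrak{m}=\mathfrak{m}_2\circ\mathfrak{m}_1$. *)

(* Defs.v *)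
From mathcomp Require Import all_boot all_order all_algebra.
From mathcomp Require Import reals.

Set Implicit Arguments.
Unset Strict Implicit.
Unset Printing Implicit Defensive.

Import Order.TTheory GRing.Theory Num.Theory.
Local Open Scope ring_scope.

Definition pospart (R : realType) (x : R) : R := Num.max x 0.

Definition trop_m1 (R : realType) (p : R) (v : R * R) : R * R :=
  (- v.1, v.2 + p * pospart v.1).

Definition trop_m2 (R : realType) (q : R) (v : R * R) : R * R :=
  (v.1 + q * pospart v.2, - v.2).

Definition trop_m (R : realType) (p q : R) : R * R -> R * R :=
  trop_m2 q \o trop_m1 p.

Definition phi (R : realType) (p q : R) (v : R * R) : R :=
  let: (s, t) := v in
  if (s < 0) && (0 < t)
  then p * s ^+ 2 - p * q * s * t + q * t ^+ 2
  else p * s ^+ 2 + p * q * s * t + q * t ^+ 2.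

(* Main.v *)
(** Neither [m1] nor [m2] preserves [phi], but each does so up to the central
    symmetry: [phi (m2 v) = phi (- v)] and [phi (- m1 v) = phi v].  The two sign
    changes cancel in [m2 \o m1]. *)
Require Import Defs.
From mathcomp Require Import all_boot all_order all_algebra.
From mathcomp Require Import reals.
From mathcomp Require Import ring.

Import Order.TTheory GRing.Theory Num.Theory.
Local Open Scope ring_scope.

(** With one coordinate fixed, [phi] is, according to its sign, either even in the other or a single
    quadratic in it. Each lemma compares two points swapped by that symmetry: a sign change or a
    Vieta involution. *)

Lemma phi_trop_m2 (R : realType) (p q s t : R) :
  phi p q (trop_m2 q (s, t)) = phi p q (- s, - t).
Proof.
rewrite /trop_m2 /phi /pospart /= !oppr_gt0 oppr_lt0.
have [t0|t0|->] := ltgtP t 0; rewrite ?andbF ?andbT; last by ring.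
  by rewrite mulr0 addr0; have [s0|s0|->] := ltgtP s 0; ring.
(* Here [0 < t]: [- s] and [s + q * t] sum to [q * t], so [p * x ^+ 2 - p * q * t * x] agrees at
   both. *)
by ring.
Qed.

Lemma phi_opp_trop_m1 (R : realType) (p q s t : R) :
  phi p q (- (trop_m1 p (s, t)).1, - (trop_m1 p (s, t)).2) = phi p q (s, t).
Proof.
rewrite /trop_m1 /phi /pospart /= opprK oppr_gt0.
have [s0|s0|->] := ltgtP s 0; last by rewrite !mulr0; ring.
  (* For [s < 0] the cross term is [p * q * |s| * |t|], even in [t]. *)
  by rewrite mulr0 addr0 /=; have [t0|t0|->] := ltgtP t 0; ring.
by rewrite /=; ring.
Qed.

Theorem theorem3p5 (R : realType) (p q : R) (hp : 0 < p) (hq : 0 < q) :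
  phi p q \o trop_m p q =1 phi p q.
Proof.
(* Only the right-hand side is rewritten, up to [phi (m2 (m1 v))]. *)
by move=> [s t]; rewrite -(phi_opp_trop_m1 R p q s t) -phi_trop_m2.
Qed.
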